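(* Let $\mathbb{F}$ be an infinite field of characteristic $p\neq 2$, and let $n=4$, $d=2$. Then the set $$\sigma_2(Z_i),\ \det(Z_i)\quad(i=1,2),$$ $$\operatorname{tr}(Z_1Z_2),\ \sigma_2(Z_1Z_2),\ \operatorname{tr}(Z_1^2Z_2^2),\ \operatorname{tr}(Z_1^3Z_2),\ \operatorname{tr}(Z_1Z_2^3)$$ is a minimal (with respect to inclusion) separating set for the algebra $R_-^{O(4)}$ of $O(4)$-invariants of two skew-symmetric $4\times 4$ matrices.
   Context: Let $R_-=\mathbb{F}[x_{ij}(k)\mid 1\le j<i\le n,\ 1\le k\le d]$, and let $Z_k$ ($1\le k\le d$) be the $n\times n$ skew-symmetric generic matrix with $(i,j)$ entry $x_{ij}(k)$ if $i>j$, $0$ if $i=j$, and $-x_{ji}(k)$ if $i<j$. For an $n\times n$ matrix $A$ over a commutative ring, $\sigma_t(A)$ denotes the $t$-th coefficient of the characteristic polynomial, normalized by $\det(\lambda I-A)=\sum_{t=0}^n(-1)^t\sigma_t(A)\lambda^{n-t}$; so $\sigma_1=\operatorname{tr}$, $\sigma_n=\det$. Let $M(n)$ be the space of $n\times n$ matrices over $\mathbb{F}$, $S_-(n)=\{A\in M(n)\mid A^T=-A\}$, $O(n)=\{A\in M(n)\mid AA^T=I_n\}$, and $H_-=S_-(n)^{\oplus d}$, on which $O(n)$ acts by $g\cdot(A_1,\ldots,A_d)=(gA_1g^{-1},\ldots,gA_dg^{-1})$. Elements of $R_-$ are regarded as polynomial functions $H_-\to\mathbb{F}$, where $x_{ij}(k)$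 sends $(A_1,\ldots,A_d)$ to the $(i,j)$ entry of $A_k$. The algebra $R_-^{O(n)}=\{f\in R_-\mid f(g\cdot v)=f(v)\ \text{for all } g\in O(n),\ v\in H_-\}$ is (by a known theorem, for $p\ne2$) the $\mathbb{F}$-subalgebra of $R_-$ generated by all $\sigma_t(b)$, where $1\le t\le n$ and $b$ ranges over all monomials in $Z_1,\ldots,Z_d$. A subset $S\subset R_-^{O(n)}$ separates $u,v\in H_-$ if there is $f\in S$ with $f(u)\ne f(v)$. The set $S$ is called separating if any $u,v\in H_-$ that are separated by $R_-^{O(n)}$ are separated by $S$. A separating set is minimal if no proper subset of it is separating. *)

(* Defs.v *)
From HB Require Import structures.
From mathcomp Require Import all_boot all_order all_algebra.
From mathcomp Require Import mpoly.

Set Implicit Arguments.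
Unset Strict Implicit.
Unset Printing Implicit Defensive.

Import GRing.Theory.
Local Open Scope ring_scope.

Definition infinite_type (T : eqType) : Prop :=
  ~ exists s : seq T, forall x : T, x \in s.

(* sigma_t(A) for t <= n, i.e.
   det(lambda I - A) = \sum_(t <= n) (-1)^t sigma_t(A) lambda^(n - t);
   for t > n the truncated subtraction makes the value meaningless. *)
Definition sigma (R : comNzRingType) (n t : nat) (A : 'M[R]_n) : R :=
  (-1) ^+ t * (char_poly A)`_(n - t).

(* The triples (i, j, k) with j < i indexing the variables x_ij(k). *)
Notation skew_idx n d := {x : 'I_n * 'I_n * 'I_d | (x.1.2 < x.1.1)%N}.

(* The ring R_-; mpoly indexes its variables by an ordinal type, hence the
   transport along enum_rank / enum_val below. *)
Notation Rminus F n d := {mpoly F[#|{: skew_idx n d}|]}.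

(* insub (i, j, k) is Some exactly when j < i. *)
Definition Z (F : fieldType) (n d : nat) (k : 'I_d) : 'M[Rminus F n d]_n :=
  \matrix_(i, j)
    if insub (i, j, k) is Some s then 'X_(enum_rank (s : skew_idx n d))
    else if insub (j, i, k) is Some s then - 'X_(enum_rank (s : skew_idx n d))
    else 0.

Section Separating.
Variables (F : fieldType) (n d : nat).

Definition tuples := 'I_d -> 'M[F]_n.

Definition Hminus (v : tuples) : Prop := forall k, (v k)^T = - v k.

Definition orthogonal (g : 'M[F]_n) : Prop := g *m g^T = 1%:M.

Definition act (g : 'M[F]_n) (v : tuples) : tuples :=
  fun k => g *m v k *m invmx g.

Definition evalH (f : Rminus F n d) (v : tuples) : F :=
  f.@[fun m => let: (i, j, k) := val (enum_val m) in v k i j].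

Definition invariant (f : Rminus F n d) : Prop :=
  forall g v, orthogonal g -> Hminus v -> evalH f (act g v) = evalH f v.

Definition separates (S : Rminus F n d -> Prop) (u v : tuples) : Prop :=
  exists2 f, S f & evalH f u <> evalH f v.

Definition separating (S : Rminus F n d -> Prop) : Prop :=
  (forall f, S f -> invariant f) /\
  (forall u v, Hminus u -> Hminus v ->
     separates invariant u v -> separates S u v).

Definition minimal_separating (S : Rminus F n d -> Prop) : Prop :=
  separating S /\
  (forall S' : Rminus F n d -> Prop,
     (forall f, S' f -> S f) -> ~ (forall f, S f -> S' f) -> ~ separating S').

End Separating.

(* Main.v *)
(* A skew-symmetric 4x4 matrix is the sum of its self-dual and anti-self-dual
   parts, two vectors a, b of F^3, and SO(4) acts on a and b by rotations while
   the reflections of O(4) exchange them up to sign. Write p_ij = <a_i, a_j>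
   and q_ij = <b_i, b_j> for the Gram entries of two such matrices,
   s = p + q and d = p - q. The nine functions are, up to scalars and
   polynomials in the preceding ones, the s_ij and the products d_ij d_kl; they
   determine the unordered pair {p, q}. Conversely an invariant polynomial
   depends on {p, q} only: over an infinite field its invariance extends to
   all reflections acting on the a_i alone, and a polynomial function of two
   vectors invariant under reflections is a function of their Gram matrix (Witt
   extension, plus a degeneration along isotropic vectors). Minimality follows
   from explicit pairs of points that differ at one function only. *)
Require Import Defs.
From HB Require Import structures.
From mathcomp Require Import all_boot all_order all_algebra.
From mathcomp Require Import mpoly.
From mathcomp Require Import ring.

Set Implicit Arguments.
Unset Strict Implicit.
Unset Printing Implicit Defensive.

Import GRing.Theory.
Local Open Scope ring_scope.

(** * Functions of two vectors invariant under reflections *)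

Section PolynomialFunctions.
Variable F : fieldType.
Hypothesis Finf : infinite_type F.

(** Infinitude of [S] is a negative statement, so it yields a fresh root only while the goal is
    [False]. Roots are accumulated in [s] until there are too many for a nonzero [p]. *)
Lemma poly_eq0_on (S : F -> Prop) (p : {poly F}) :
    (forall s : seq F, ~ forall x, S x -> x \in s) ->
    (forall x, S x -> p.[x] = 0) -> p = 0.
Proof.
move=> Sinf p0; case: (eqVneq p 0) => // nz_p; exfalso.
suff grow k (s : seq F) :
    uniq s -> all (root p) s -> (size p <= k + size s)%N -> False.
  by apply: (grow (size p) [::]); rewrite ?leq_addr.
elim: k s => [|k IHk] s us ps; first by rewrite leqNgt max_poly_roots.
rewrite addSnnS => sz; apply: (Sinf s) => x Sx; apply: contraT => xNs.
case: (IHk (x :: s)); rewrite //= ?xNs // ps andbT.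
by apply/rootP/p0.
Qed.

Lemma poly_eq0_infinite (p : {poly F}) : (forall t, p.[t] = 0) -> p = 0.
Proof.
move=> p0; apply: (@poly_eq0_on (fun=> True)) => // s alls.
by apply: Finf; exists s => x; apply: alls.
Qed.

Definition polyfun (h : F -> F) := exists p : {poly F}, forall t, h t = p.[t].

(** Density of the nonvanishing locus of [w]: the polynomial of [(h - c) w] vanishes everywhere, and
    [{poly F}] is a domain. *)
Lemma polyfun_ext (h w : F -> F) (c t0 t : F) :
    polyfun h -> polyfun w -> w t0 != 0 ->
  (forall s, w s != 0 -> h s = c) -> h t = c.
Proof.
move=> [p hp] [q wq] nz_q hc; rewrite hp.
have /poly_eq0_infinite/eqP : forall s, ((p - c%:P) * q).[s] = 0.
  move=> s; rewrite hornerM !hornerE -hp -wq.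
  by case: (eqVneq (w s) 0) => [->|/hc->]; rewrite ?mulr0 // subrr mul0r.
rewrite mulf_eq0 subr_eq0 => /orP[/eqP->|/eqP q0]; first by rewrite hornerC.
by rewrite wq q0 horner0 eqxx in nz_q.
Qed.

End PolynomialFunctions.

(** * The standard bilinear form and its reflections *)

Section Gram.
Variables (F : fieldType) (n : nat).
Implicit Types (x y z u w a b : 'rV[F]_n).

Definition dot x y : F := (x *m y^T) 0 0.

Lemma dotC x y : dot x y = dot y x.
Proof. by rewrite /dot -[x *m _]trmxK trmx_mul trmxK mxE. Qed.
Lemma dotDl x y z : dot (x + y) z = dot x z + dot y z.
Proof. by rewrite /dot mulmxDl mxE. Qed.
Lemma dotZl c x z : dot (c *: x) z = c * dot x z.
Proof. by rewrite /dot -scalemxAl mxE. Qed.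
Lemma dotNl x z : dot (- x) z = - dot x z.
Proof. by rewrite /dot mulNmx mxE. Qed.
Lemma dotDr x y z : dot z (x + y) = dot z x + dot z y.
Proof. by rewrite dotC dotDl !(dotC z). Qed.
Lemma dotZr c x z : dot z (c *: x) = c * dot z x.
Proof. by rewrite dotC dotZl (dotC z). Qed.
Lemma dotNr x z : dot z (- x) = - dot z x.
Proof. by rewrite dotC dotNl (dotC z). Qed.
Lemma dot0l x : dot 0 x = 0.
Proof. by rewrite /dot mul0mx mxE. Qed.
Definition dotE := (dotDl, dotZl, dotNl, dotDr, dotZr, dotNr).

Definition refl u x := x - (2%:R * dot u x / dot u u) *: u.

Lemma refl_dot u x y : dot u u != 0 -> dot (refl u x) (refl u y) = dot x y.
Proof. by move=> nz; rewrite /refl !dotE (dotC x u); field. Qed.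

Lemma refl_orth u x : dot u x = 0 -> refl u x = x.
Proof. by move=> ux; rewrite /refl ux mulr0 mul0r scale0r subr0. Qed.

Lemma reflD u x y : refl u (x + y) = refl u x + refl u y.
Proof. by rewrite /refl dotDr mulrDr mulrDl scalerDl opprD addrACA. Qed.

Lemma reflZ u c x : refl u (c *: x) = c *: refl u x.
Proof. by rewrite /refl dotZr scalerBr scalerA; congr (_ - _ *: _); ring. Qed.

Lemma refl_self u : dot u u != 0 -> refl u u = - u.
Proof.
move=> nz; rewrite /refl -mulrA divff // mulr1 scaler_nat mulr2n opprD addrA.
by rewrite subrr add0r.
Qed.

Lemma refl_sub x y : dot x x = dot y y -> dot (x - y) (x - y) != 0 ->
  refl (x - y) x = y.
Proof.
move=> xy nz; rewrite /refl.
suff -> : 2%:R * dot (x - y) x = dot (x - y) (x - y).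
  by rewrite divff // scale1r opprB addrC subrK.
by rewrite !dotE xy (dotC y x); ring.
Qed.

Lemma refl_add x y : dot x x = dot y y -> dot (x + y) (x + y) != 0 ->
  refl (x + y) x = - y.
Proof.
by move=> xy nz; rewrite -{1}[y]opprK refl_sub ?opprK // !dotE xy opprK.
Qed.

(** Completes [w] to a hyperbolic pair inside the orthogonal complement of [a]: a coordinate vector
    not orthogonal to [w] is projected off [a], scaled, and made isotropic by adding a multiple of
    [w]. Allowing [a = 0] covers the case of no constraint. *)
Lemma isotropic_partner (char2 : 2%:R != 0 :> F) w a :
    w != 0 -> dot w w = 0 -> dot a w = 0 -> (a == 0) || (dot a a != 0) ->
  exists z, [/\ dot z z = 0, dot w z = 1 & dot a z = 0].
Proof.
move=> nz_w ww aw nz_a.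
have /existsP[i nz_i] : [exists i, w 0 i != 0].
  apply: contraNT nz_w; rewrite negb_exists => /forallP w0.
  by apply/eqP/rowP=> i; have /negPn/eqP-> := w0 i; rewrite mxE.
pose e : 'rV[F]_n := delta_mx 0 i.
have we : dot w e != 0.
  by rewrite /dot trmx_delta -colE mxE.
pose y := e - (dot a e / dot a a) *: a.
have ay : dot a y = 0.
  rewrite !dotE; case/orP: nz_a => [/eqP-> | nz].
    by rewrite !dot0l !mul0r subr0.
  by field.
have wy : dot w y = dot w e by rewrite !dotE (dotC w a) aw; ring.
clearbody y; rewrite -wy in we; clear wy.
exists ((dot w y)^-1 *: y - (dot y y / (2%:R * dot w y ^+ 2)) *: w).
by split; rewrite !dotE ?ww ?aw ?ay ?(dotC y w); field; rewrite ?we.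
Qed.

End Gram.

(** * Reflection-invariant polynomial functions depend on the Gram matrix only *)

Section GramInvariance.
Variables (F : fieldType) (n : nat).
Hypothesis Finf : infinite_type F.
Hypothesis char2 : 2%:R != 0 :> F.
Implicit Types (x y z u w a b : 'rV[F]_n) (Phi : 'rV[F]_n -> 'rV[F]_n -> F).

Definition polyfun2 Phi := forall x y x' y',
  polyfun (fun t => Phi (x + t *: x') (y + t *: y')).

Definition refl_inv Phi := forall u x y, dot u u != 0 ->
  Phi (refl u x) (refl u y) = Phi x y.

(* The reflection along [w - t z] maps [x], orthogonal to [w], to
   [x - <x, z> w + t <x, z> z], and the orbit is closed up by letting [t]
   tend to 0. *)
Lemma isotropic_degeneration Phi w z x y :
    polyfun2 Phi -> refl_inv Phi ->
    dot w w = 0 -> dot z z = 0 -> dot w z = 1 -> dot x w = 0 -> dot y w = 0 ->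
  Phi x y = Phi (x - dot x z *: w) (y - dot y z *: w).
Proof.
move=> polPhi invPhi ww zz wz xw yw.
pose h t := Phi ((x - dot x z *: w) + t *: (dot x z *: z))
                ((y - dot y z *: w) + t *: (dot y z *: z)).
have -> : Phi (x - dot x z *: w) (y - dot y z *: w) = h 0.
  by rewrite /h !scale0r !addr0.
apply/esym; apply: (@polyfun_ext _ Finf h (fun t => t) _ 1).
- exact: polPhi.
- by exists 'X => t; rewrite hornerX.
- exact: oner_neq0.
move=> t nz_t; rewrite /h.
have norm : dot (w - t *: z) (w - t *: z) = - (2%:R * t).
  by rewrite !dotE ww zz (dotC z w) wz; ring.
have reflE v : dot v w = 0 ->
    refl (w - t *: z) v = v - dot v z *: w + t *: (dot v z *: z).
  move=> vw; rewrite /refl norm !dotE (dotC w) vw (dotC z v).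
  have -> : 2%:R * (0 + - (t * dot v z)) / - (2%:R * t) = dot v z.
    by field; rewrite oppr_eq0 mulf_neq0.
  by apply/rowP=> i; rewrite !mxE; ring.
by rewrite -!reflE // invPhi // norm oppr_eq0 mulf_neq0.
Qed.

(** Degenerating along [w = x] contracts [x] to 0 and changes [y] by a multiple of [x], hence keeps
    it isotropic; a second degeneration then contracts that vector too. *)
Lemma totally_isotropic_eq Phi x y : polyfun2 Phi -> refl_inv Phi ->
  dot x x = 0 -> dot x y = 0 -> dot y y = 0 -> Phi x y = Phi 0 0.
Proof.
move=> polPhi invPhi xx xy yy.
have step v : dot v v = 0 -> Phi 0 v = Phi 0 0.
  move=> vv; have [->//|nz_v] := eqVneq v 0.
  have [|z [zz vz _]] := isotropic_partner char2 nz_v vv (dot0l v).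
    by rewrite eqxx.
  rewrite (isotropic_degeneration polPhi invPhi vv zz vz) ?dot0l //.
  by rewrite vz scale0r subr0 scale1r subrr.
have [->|nz_x] := eqVneq x 0; first exact: step.
have [|z [zz xz _]] := isotropic_partner char2 nz_x xx (dot0l x).
  by rewrite eqxx.
rewrite (isotropic_degeneration polPhi invPhi xx zz xz) //; last by rewrite dotC.
rewrite xz scale1r subrr; apply: step.
by rewrite !dotE (dotC y x) xx xy yy; ring.
Qed.

(* With [y = lambda a + m] and [m] orthogonal to [a], either [m - m'] or
   [m + m'] is anisotropic, or both [m] and [m'] are isotropic and can be
   contracted to 0. *)
Lemma Gram_eq_fixed Phi a y y' : polyfun2 Phi -> refl_inv Phi ->
    dot a a != 0 -> dot a y = dot a y' -> dot y y = dot y' y' ->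
  Phi a y = Phi a y'.
Proof.
move=> polPhi invPhi nz_a ay yy.
pose l := dot a y / dot a a; pose m := y - l *: a; pose m' := y' - l *: a.
have -> : y = l *: a + m by rewrite addrC subrK.
have -> : y' = l *: a + m' by rewrite addrC subrK.
have am : dot a m = 0 by rewrite /m !dotE /l; field.
have am' : dot a m' = 0 by rewrite /m' !dotE /l -ay; field.
have mm : dot m m = dot m' m'.
  by rewrite /m /m' !dotE (dotC _ a) (dotC _ a) ay yy.
clearbody l m m'; clear ay yy y y'.
have move_m u : dot a u = 0 -> dot u u != 0 -> forall v,
    Phi a (l *: a + v) = Phi a (l *: a + refl u v).
  move=> au nz_u v; rewrite -(invPhi u a) // reflD reflZ refl_orth //.
  by rewrite dotC.
have [m0|nz_m] := eqVneq (dot m m) 0.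
  have contract v : dot a v = 0 -> dot v v = 0 ->
      Phi a (l *: a + v) = Phi a (l *: a).
    move=> av vv; have [->|nz_v] := eqVneq v 0; first by rewrite addr0.
    have [|z [zz vz az]] := isotropic_partner char2 nz_v vv av.
      by rewrite nz_a orbT.
    rewrite (isotropic_degeneration polPhi invPhi vv zz vz) //; last first.
      by rewrite !dotE av vv; ring.
    rewrite !dotE az vz mulr0 add0r scale0r subr0 scale1r.
    by rewrite addrK.
  by rewrite !contract // -mm.
have [eq_sub|nz_sub] := eqVneq (dot (m - m') (m - m')) 0; last first.
  by rewrite (move_m _ _ nz_sub) ?refl_sub // !dotE am am'; ring.
have nz_add : dot (m + m') (m + m') != 0.
  apply: contra nz_m => /eqP eq_add.
  suff /eqP : 2%:R * 2%:R * dot m m = 0 by rewrite !mulf_eq0 (negPf char2).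
  have -> : 2%:R * 2%:R * dot m m =
      dot (m - m') (m - m') + dot (m + m') (m + m').
    by rewrite !dotE (dotC m' m) -mm; ring.
  by rewrite eq_sub eq_add addr0.
rewrite (move_m _ _ nz_add) ?refl_add //; last by rewrite !dotE am am' addr0.
by rewrite (move_m m') -?mm // -scaleN1r reflZ refl_self -?mm // scaleN1r opprK.
Qed.

(** Witt's argument: the norms of [x - x'] and [x + x'] add up to [4 <x, x>], so one of them is
    nonzero. Either the reflection along [x - x'], or the one along [x + x'] followed by the one
    along [x'], carries [x] to [x'], which reduces to [Gram_eq_fixed]. *)
Lemma Gram_eq_anisotropic Phi x y x' y' : polyfun2 Phi -> refl_inv Phi ->
    dot x x != 0 ->
    dot x x = dot x' x' -> dot x y = dot x' y' -> dot y y = dot y' y' ->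
  Phi x y = Phi x' y'.
Proof.
move=> polPhi invPhi nz_x xx xy yy.
suff [y2 [-> xy2 yy2]] : exists y2,
    [/\ Phi x y = Phi x' y2, dot x y = dot x' y2 & dot y y = dot y2 y2].
  by apply: Gram_eq_fixed; rewrite -?xx -?yy2 -?xy2.
have [eq_sub|nz_sub] := eqVneq (dot (x - x') (x - x')) 0; last first.
  have x'E := refl_sub xx nz_sub; exists (refl (x - x') y).
  split; last by rewrite refl_dot.
  - by rewrite -(invPhi (x - x')) // x'E.
  - by rewrite -[X in _ = dot X _]x'E refl_dot.
have nz_add : dot (x + x') (x + x') != 0.
  apply: contra nz_x => /eqP eq_add.
  suff /eqP : 2%:R * 2%:R * dot x x = 0 by rewrite !mulf_eq0 (negPf char2).
  have -> : 2%:R * 2%:R * dot x x =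
      dot (x - x') (x - x') + dot (x + x') (x + x').
    by rewrite !dotE (dotC x' x) -xx; ring.
  by rewrite eq_sub eq_add addr0.
have nz_x' : dot x' x' != 0 by rewrite -xx.
have x'E : refl x' (refl (x + x') x) = x'.
  by rewrite refl_add // -scaleN1r reflZ refl_self // scaleN1r opprK.
exists (refl x' (refl (x + x') y)); split; last by rewrite !refl_dot.
- by rewrite -(invPhi (x + x')) // -(invPhi x') // x'E.
- by rewrite -[X in _ = dot X _]x'E !refl_dot.
Qed.

Lemma Gram_eq Phi x y x' y' : polyfun2 Phi -> refl_inv Phi ->
    dot x x = dot x' x' -> dot x y = dot x' y' -> dot y y = dot y' y' ->
  Phi x y = Phi x' y'.
Proof.
move=> polPhi invPhi xx xy yy.
have [x0|nz_x] := eqVneq (dot x x) 0; last exact: Gram_eq_anisotropic.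
have [y0|nz_y] := eqVneq (dot y y) 0; last first.
  apply: (@Gram_eq_anisotropic (fun a b => Phi b a) y x y' x') => //.
  - by move=> u a b; apply: invPhi.
  - by rewrite dotC xy dotC.
have [xy0|nz_xy] := eqVneq (dot x y) 0.
  rewrite [LHS]totally_isotropic_eq // [RHS]totally_isotropic_eq //.
  - by rewrite -xx.
  - by rewrite -xy.
  - by rewrite -yy.
(* Now [x] and [y] are isotropic with nonzero product, and [x + y] has norm [2 <x, y>]. The shear is
   linear and commutes with reflections, so [Psi] inherits both hypotheses on [Phi]. *)
pose Psi a b := Phi (a - b) b.
have PsiE a b : Phi a b = Psi (a + b) b by rewrite /Psi addrK.
rewrite !PsiE; apply: Gram_eq_anisotropic.
- move=> a b a' b'; have [p pE] := polPhi (a - b) b (a' - b') b'.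
  exists p => t; rewrite -pE /Psi; congr Phi.
  by rewrite scalerBr opprD addrACA.
- move=> u a b nz_u; rewrite /Psi -(invPhi u (a - b)) //.
  by rewrite reflD -[in RHS]scaleN1r reflZ scaleN1r.
- rewrite !dotE x0 y0 (dotC y x) add0r addr0 -mulr2n -mulr_natl.
  by rewrite mulf_neq0.
- by rewrite !dotE (dotC y x) (dotC y' x') xx xy yy.
- by rewrite !dotE xy yy.
- by [].
Qed.

End GramInvariance.

(** * Conjugation by complex structures *)

Section Evaluation.
Variables (F : fieldType) (n d : nat).
Implicit Types (f : Rminus F n d) (u v : tuples F n d).

Lemma evalH_ext f u v : (forall k, u k = v k) -> evalH f u = evalH f v.
Proof.
by move=> uv; apply: meval_eq => m; case: (val _) => [[i j] k]; rewrite uv.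
Qed.

(** Clearing the common denominator [D]. The exponent adds up the degrees of all monomials instead
    of taking their maximum, which keeps the induction free of comparisons. *)
Lemma meval_rational m (f : {mpoly F[m]}) (x : 'I_m -> {poly F}) (D : {poly F}) :
  exists k (P : {poly F}), forall s, D.[s] != 0 ->
    D.[s] ^+ k * f.@[fun i => (x i).[s] / D.[s]] = P.[s].
Proof.
elim/mpolyind: f => [|c mu f _ _ [k [P PE]]].
  by exists 0%N, 0 => s _; rewrite meval0 mulr0 horner0.
exists (k + mdeg mu)%N, (D ^+ k * (c *: \prod_i x i ^+ mu i) + D ^+ mdeg mu * P).
move=> s nz; rewrite mevalD mevalZ mevalX exprD.
have prodE : D.[s] ^+ mdeg mu * \prod_i ((x i).[s] / D.[s]) ^+ mu i =
    (\prod_i x i ^+ mu i).[s].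
  rewrite horner_prod mdegE -prodrXr -big_split /=; apply: eq_bigr => i _.
  by rewrite hornerE expr_div_n mulrCA divff ?mulr1 // expf_neq0.
by rewrite hornerD !hornerM hornerZ !horner_exp -PE // -prodE; ring.
Qed.

Lemma evalH_rational f (M : 'I_d -> 'M[{poly F}]_n) (D : {poly F}) :
  exists k (P : {poly F}), forall s, D.[s] != 0 ->
    D.[s] ^+ k *
      evalH f (fun r => D.[s]^-1 *: map_mx (fun p : {poly F} => p.[s]) (M r)) =
    P.[s].
Proof.
pose x m := let: (i, j, r) := val (@enum_val (skew_idx n d) predT m) in M r i j.
have [k [P PE]] := meval_rational f x D.
exists k, P => s nz; rewrite -PE //; congr (_ * _); apply: meval_eq => m.
by rewrite /x; case: (val _) => [[i j] r]; rewrite !mxE mulrC.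
Qed.

Lemma evalH_line f v w : polyfun (fun t => evalH f (fun k => v k + t *: w k)).
Proof.
pose M k := map_mx polyC (v k) + 'X *: map_mx polyC (w k).
have [k [P PE]] := evalH_rational f M 1.
exists P => t; rewrite -PE hornerC ?oner_neq0 // expr1n mul1r.
by apply: evalH_ext => r; apply/matrixP=> i j; rewrite !mxE !hornerE invr1 mul1r.
Qed.

Lemma act_orthogonal g v k : Defs.orthogonal g -> act g v k = g *m v k *m g^T.
Proof.
move=> g_orth; congr (_ *m _).
have [ug _] := mulmx1_unit g_orth.
by rewrite -[invmx g]mulmx1 -g_orth mulKmx.
Qed.

Lemma act_Hminus g v : Defs.orthogonal g -> Hminus v -> Hminus (act g v).
Proof.
move=> g_orth skew_v k.
by rewrite !act_orthogonal // !trmx_mul trmxK skew_v mulNmx mulmxN mulmxA.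
Qed.

End Evaluation.

(** * Invariance under conjugation by skew matrices with scalar square *)

Section ComplexStructure.
Variables (F : fieldType) (n d : nat).
Hypothesis Finf : infinite_type F.
Hypothesis char2 : 2%:R != 0 :> F.
Implicit Types (f : Rminus F n d) (v : tuples F n d).

(** The matrix [c (s + A)] is orthogonal because [(s + A) (s - A) = s^2 + N]; the left-hand side is
    the expanded conjugate [(s + A) v (s - A) / (s^2 + N)]. *)
Lemma evalH_cayley f v (A : 'M[F]_n) (N s c : F) :
    Defs.invariant f -> Hminus v -> A^T = - A -> A *m A = (- N)%:M ->
    c ^+ 2 * (s ^+ 2 + N) = 1 ->
  evalH f (fun k => (s ^+ 2 + N)^-1 *: (s ^+ 2 *: v k
    + s *: (A *m v k - v k *m A) - A *m v k *m A)) = evalH f v.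
Proof.
move=> inv_f skew_v skewA AA cN; pose g := c *: (s%:M + A).
have c2 : (s ^+ 2 + N)^-1 = c * c.
  by rewrite -expr2; apply: mulr1_eq; rewrite mulrC.
have gT : g^T = c *: (s%:M - A).
  by rewrite linearZ linearD /= skewA tr_scalar_mx.
have g_orth : Defs.orthogonal g.
  rewrite /Defs.orthogonal gT -scalemxAl -scalemxAr scalerA.
  rewrite mulmxDl !mulmxBr AA !mul_scalar_mx mul_mx_scalar.
  apply/matrixP=> i j; rewrite !mxE -cN.
  by case: (i == j); rewrite ?mulr1n ?mulr0n; ring.
rewrite -(inv_f g v g_orth skew_v); apply: evalH_ext => k.
rewrite act_orthogonal // gT -!scalemxAl -!scalemxAr scalerA c2; congr (_ *: _).
rewrite !mulmxDl !mulmxBr !mul_scalar_mx !mul_mx_scalar -!scalemxAl.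
by apply/matrixP=> i j; rewrite !mxE; ring.
Qed.

(* [s + A] is a multiple of an orthogonal matrix whenever [s ^ 2 + N] is a
   square, which happens at s = (y ^ 2 - N) / (2 y). These [s] are infinitely
   many, so invariance under conjugation by [s + A] extends to [s = 0]. *)
Lemma evalH_complex_structure f v (A : 'M[F]_n) (N : F) :
    Defs.invariant f -> Hminus v -> A^T = - A -> A *m A = (- N)%:M -> N != 0 ->
  evalH f (fun k => - N^-1 *: (A *m v k *m A)) = evalH f v.
Proof.
move=> inv_f skew_v skewA AA nzN.
pose D : {poly F} := 'X ^+ 2 + N%:P.
have DE s : D.[s] = s ^+ 2 + N by rewrite !hornerE.
pose M k := 'X ^+ 2 *: map_mx polyC (v k)
  + 'X *: map_mx polyC (A *m v k - v k *m A) - map_mx polyC (A *m v k *m A).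
have [k [P PE]] := evalH_rational f M D.
pose h s := evalH f (fun k => (s ^+ 2 + N)^-1 *: (s ^+ 2 *: v k
    + s *: (A *m v k - v k *m A) - A *m v k *m A)).
have hE s : D.[s] != 0 -> D.[s] ^+ k * h s = P.[s].
  move=> nz; rewrite -PE //; congr (_ * _); apply: evalH_ext => r.
  by rewrite DE; congr (_ *: _); apply/matrixP=> i j; rewrite !mxE !hornerE.
pose Q := P - evalH f v *: D ^+ k.
suff Q0 : Q = 0.
  have nzD : D.[0] != 0 by rewrite DE expr0n add0r.
  apply/esym; transitivity (h 0).
    apply: (mulfI (expf_neq0 k nzD)); rewrite hE //.
    by rewrite (subr0_eq Q0) hornerZ horner_exp mulrC.
  apply: evalH_ext => r; rewrite expr0n !scale0r !add0r.
  by rewrite scalerN scaleNr.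
pose S s := exists2 y, (y != 0) && (y ^+ 2 + N != 0)
  & s = (y ^+ 2 - N) / (2%:R * y).
apply: (@poly_eq0_on _ S) => [rs Srs|_ [y /andP[nzy nzyN] ->]].
  (* If the list [rs] contained all of [S], then [W] would vanish everywhere: its first two factors
     handle the excluded [y], and a quadratic factor vanishes at [y] when [(y^2 - N) / (2 y)] is its
     [s]. Yet no factor is zero. *)
  pose W : {poly F} :=
    'X * D * \prod_(s <- rs) ('X ^+ 2 - N%:P - (2%:R * s) *: 'X).
  have /(poly_eq0_infinite Finf)/eqP : forall y, W.[y] = 0.
    move=> y; rewrite !hornerM hornerX DE horner_prod.
    have [->|nzy] := eqVneq y 0; first by rewrite !mul0r.
    have [->|nzyN] := eqVneq (y ^+ 2 + N) 0; first by rewrite mulr0 mul0r.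
    have /Srs yrs : S ((y ^+ 2 - N) / (2%:R * y)) by exists y; rewrite ?nzy.
    apply/eqP; rewrite mulf_eq0; apply/orP; right.
    rewrite prodf_seq_eq0; apply/hasP; eexists; first exact: yrs.
    rewrite /= !(hornerD, hornerN) hornerXn hornerC hornerZ hornerX.
    by apply/eqP; field; rewrite char2 nzy.
  rewrite !mulf_eq0 polyX_eq0 /= => /orP[/eqP D0|].
    have := DE 0.
    by rewrite D0 horner0 expr0n add0r => /esym/eqP; rewrite (negPf nzN).
  rewrite prodf_seq_eq0 => /hasP[s _ /= /eqP W0].
  have /eqP := congr1 (fun p : {poly F} => p`_2) W0.
  by rewrite !coefE /= mulr0 !subr0 oner_eq0.
have nz2y : 2%:R * y != 0 by rewrite mulf_neq0.
(* For this [s], [s^2 + N] is the square of [(y^2 + N) / (2 y)]. *)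
pose c := 2%:R * y / (y ^+ 2 + N).
have cE : c ^+ 2 * (((y ^+ 2 - N) / (2%:R * y)) ^+ 2 + N) = 1.
  by rewrite /c; field; apply/and3P.
have nzD : D.[(y ^+ 2 - N) / (2%:R * y)] != 0.
  by apply/eqP; rewrite DE => D0; move/eqP: cE; rewrite D0 mulr0 eq_sym oner_eq0.
rewrite /Q hornerD hornerN hornerZ horner_exp -hE // /h.
rewrite (evalH_cayley inv_f skew_v skewA AA cE).
by rewrite mulrC subrr.
Qed.

End ComplexStructure.

(** * The splitting of so(4) *)

Section Skew4.
Variable F : fieldType.
Implicit Types (a b u : 'rV[F]_3).

Lemma dot3E (a b : 'rV[F]_3) : dot a b =
  a 0 0 * b 0 0 + a 0 1 * b 0 1 + a 0 2%:R * b 0 2%:R.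
Proof.
rewrite /dot mxE !big_ord_recl big_ord0 addr0 !mxE addrA.
by congr (_ + _ * _ + _ * _); congr (_ 0 _); apply/val_inj.
Qed.

(* The splitting so(4) = so(3) + so(3): [skew4 a 0] is self-dual,
   [skew4 0 b] anti-self-dual, and the two commute. *)
Definition skew4 a b : 'M[F]_4 := \matrix_(i, j)
  nth 0 (nth [::] [::
    [:: 0; - (a 0 0 + b 0 0); - (a 0 1 + b 0 1); - (a 0 2%:R + b 0 2%:R)];
    [:: a 0 0 + b 0 0; 0; - (a 0 2%:R - b 0 2%:R); a 0 1 - b 0 1];
    [:: a 0 1 + b 0 1; a 0 2%:R - b 0 2%:R; 0; - (a 0 0 - b 0 0)];
    [:: a 0 2%:R + b 0 2%:R; - (a 0 1 - b 0 1); a 0 0 - b 0 0; 0]] i) j.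

Lemma skew4_tr a b : (skew4 a b)^T = - skew4 a b.
Proof.
apply/matrixP=> [[[|[|[|[|//]]]] ?] [[|[|[|[|//]]]] ?]];
  by rewrite !mxE /= ?oppr0 ?opprK.
Qed.

Lemma skew4D a b a' b' : skew4 (a + a') (b + b') = skew4 a b + skew4 a' b'.
Proof.
apply/matrixP=> [[[|[|[|[|//]]]] ?] [[|[|[|[|//]]]] ?]];
  by rewrite !mxE /=; ring.
Qed.

Lemma skew4Z c a b : skew4 (c *: a) (c *: b) = c *: skew4 a b.
Proof.
apply/matrixP=> [[[|[|[|[|//]]]] ?] [[|[|[|[|//]]]] ?]];
  by rewrite !mxE /=; ring.
Qed.

Lemma skew4N a b : skew4 (- a) (- b) = - skew4 a b.
Proof. by rewrite -scaleN1r -(scaleN1r b) skew4Z scaleN1r. Qed.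

(** Changing the sign of [b] is Hodge duality, and the scalar is the Pfaffian up to sign. *)
Lemma skew4_mul_dual a b : skew4 a b *m skew4 a (- b) = (dot b b - dot a a)%:M.
Proof.
apply/matrixP=> [[[|[|[|[|//]]]] ?] [[|[|[|[|//]]]] ?]];
  by rewrite !dot3E !mxE !big_ord_recl big_ord0 !mxE /=; ring.
Qed.

Lemma skew4_sqr u : skew4 u 0 *m skew4 u 0 = (- dot u u)%:M.
Proof. by rewrite -{2}[0]oppr0 skew4_mul_dual dot0l sub0r. Qed.

(** The cross terms of the two squares cancel, and each part squares to a scalar. *)
Lemma skew4_sqrD a b : skew4 a b *m skew4 a b + skew4 a (- b) *m skew4 a (- b) =
  (- (2%:R * (dot a a + dot b b)))%:M.
Proof.
have sqr_anti : skew4 0 b *m skew4 0 b = (- dot b b)%:M.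
  have {2}-> : skew4 0 b = - skew4 0 (- b) by rewrite -skew4N oppr0 opprK.
  by rewrite mulmxN skew4_mul_dual dot0l subr0 raddfN.
have -> : skew4 a b = skew4 a 0 + skew4 0 b by rewrite -skew4D addr0 add0r.
have -> : skew4 a (- b) = skew4 a 0 - skew4 0 b.
  by rewrite -skew4N -skew4D oppr0 addr0 add0r.
rewrite !mulmxDl !mulmxDr mulNmx !mulmxN mulNmx opprK skew4_sqr sqr_anti.
by apply/matrixP=> i j; rewrite !mxE; case: (i == j); rewrite ?mulr1n ?mulr0n; ring.
Qed.

(** Self-dual parts multiply like pure quaternions, [u a + a u = - 2 <u, a>], and commute with
    anti-self-dual ones. *)
Lemma skew4_anticomm u a b : skew4 u 0 *m skew4 a b =
  skew4 (- a) b *m skew4 u 0 - (2%:R * dot u a)%:M.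
Proof.
apply/matrixP=> [[[|[|[|[|//]]]] ?] [[|[|[|[|//]]]] ?]];
  by rewrite !dot3E !mxE !big_ord_recl !big_ord0 !mxE /=; ring.
Qed.

(** After division by [- dot u u], this is [- refl u] on the self-dual part and the identity on the
    other. *)
Lemma skew4_conj u a b : skew4 u 0 *m skew4 a b *m skew4 u 0 =
  skew4 (dot u u *: a - (2%:R * dot u a) *: u) (- dot u u *: b).
Proof.
rewrite skew4_anticomm mulmxBl -mulmxA skew4_sqr mul_mx_scalar mul_scalar_mx.
rewrite -scaleNr -!skew4Z -skew4D.
by congr skew4; apply/rowP=> i; rewrite !mxE; ring.
Qed.

End Skew4.

Section Cross.
Variable F : fieldType.
Implicit Types (a b x y : 'rV[F]_3).

Definition cross x y : 'rV[F]_3 := \row_i nth 0 [::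
  x 0 1 * y 0 2%:R - x 0 2%:R * y 0 1;
  x 0 2%:R * y 0 0 - x 0 0 * y 0 2%:R;
  x 0 0 * y 0 1 - x 0 1 * y 0 0] i.

Lemma cross_orthl x y : dot (cross x y) x = 0.
Proof. by rewrite dot3E !mxE /=; ring. Qed.

Lemma cross_orthr x y : dot (cross x y) y = 0.
Proof. by rewrite dot3E !mxE /=; ring. Qed.

(** Lagrange's identity: the norm is the Gram determinant. *)
Lemma cross_norm x y : dot (cross x y) (cross x y) =
  dot x x * dot y y - dot x y ^+ 2.
Proof. by rewrite !dot3E !mxE /=; ring. Qed.

End Cross.

Definition pair2 (T : Type) (X Y : T) (k : 'I_2) : T := if k == ord0 then X else Y.

(** * Invariants of O(4) as functions of two Gram matrices *)

Section O4Orbits.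
Variable F : fieldType.
Hypothesis Finf : infinite_type F.
Hypothesis char2 : 2%:R != 0 :> F.
Implicit Types (a b u x y : 'rV[F]_3) (f : Rminus F 4 2).

Lemma skew4_surj (M : 'M[F]_4) : M^T = - M -> exists a b, M = skew4 a b.
Proof.
move=> skewM; have ME i j : M i j = - M j i.
  by have /matrixP/(_ j i) := skewM; rewrite !mxE.
have Mii i j : val i = val j -> M i j = 0.
  move/val_inj=> ->; set k := j.
  apply/eqP; have /eqP := ME k k; rewrite -subr_eq0 opprK -mulr2n -mulr_natl.
  by rewrite mulf_eq0 (negPf char2).
pose half (s : F) := s / 2%:R.
exists (\row_i nth 0 [:: half (M 1 0 + M 3%:R 2%:R);
   half (M 2%:R 0 - M 3%:R 1); half (M 3%:R 0 + M 2%:R 1)] i).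
exists (\row_i nth 0 [:: half (M 1 0 - M 3%:R 2%:R);
   half (M 2%:R 0 + M 3%:R 1); half (M 3%:R 0 - M 2%:R 1)] i).
have M4 : M = \matrix_(i, j) nth 0 (nth [::] [::
    [:: 0; - M 1 0; - M 2%:R 0; - M 3%:R 0];
    [:: M 1 0; 0; - M 2%:R 1; - M 3%:R 1];
    [:: M 2%:R 0; M 2%:R 1; 0; - M 3%:R 2%:R];
    [:: M 3%:R 0; M 3%:R 1; M 3%:R 2%:R; 0]] i) j.
  apply/matrixP=> i j; rewrite !mxE -!ME.
  case: i j => [[|[|[|[|//]]]] ?] [[|[|[|[|//]]]] ?] /=;
    by [exact: Mii | congr (M _ _); apply/val_inj].
rewrite [LHS]M4.
apply/matrixP=> [[[|[|[|[|//]]]] ?] [[|[|[|[|//]]]] ?]];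
  rewrite !mxE /= /half; by field.
Qed.

Lemma pair2_Hminus a a' b b' : Hminus (pair2 (skew4 a b) (skew4 a' b')).
Proof. by move=> k; rewrite /pair2; case: ifP => _; rewrite skew4_tr. Qed.

Lemma pair2_skew4_surj (v : tuples F 4 2) : Hminus v ->
  exists a a' b b', forall k, v k = pair2 (skew4 a b) (skew4 a' b') k.
Proof.
move=> skew_v.
have [a [b vE]] := skew4_surj (skew_v ord0).
have [a' [b' vE']] := skew4_surj (skew_v ord_max).
exists a, a', b, b' => k; rewrite /pair2.
have [->//|k0] := eqVneq k ord0.
by rewrite -vE'; congr v; apply/val_inj; case: k k0 => [[|[|//]] ?].
Qed.

(** The factor [c] lets one statement serve for the vectors and for their opposites. *)
Lemma evalH_polyfun2 f b b' c :
  polyfun2 (fun x y => evalH f (pair2 (skew4 (c *: x) b) (skew4 (c *: y) b'))).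
Proof.
move=> x y x' y'.
have [p pE] := evalH_line f (pair2 (skew4 (c *: x) b) (skew4 (c *: y) b'))
  (pair2 (skew4 (c *: x') 0) (skew4 (c *: y') 0)).
exists p => t; rewrite -pE; apply: evalH_ext => k; rewrite /pair2.
by case: ifP => _; rewrite -skew4Z -skew4D scaler0 addr0 scalerDr !scalerA mulrC.
Qed.

Lemma evalH_oppr_refl f u x y b b' : Defs.invariant f -> dot u u != 0 ->
  evalH f (pair2 (skew4 (- refl u x) b) (skew4 (- refl u y) b')) =
  evalH f (pair2 (skew4 x b) (skew4 y b')).
Proof.
move=> inv_f nz_u.
rewrite -(evalH_complex_structure Finf char2 inv_f (pair2_Hminus x y b b')
  (skew4_tr u 0) (skew4_sqr u) nz_u).
have conjE a c : - (dot u u)^-1 *: (skew4 u 0 *m skew4 a c *m skew4 u 0) =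
    skew4 (- refl u a) c.
  rewrite skew4_conj -skew4Z scalerA mulrNN mulVf // scale1r; congr (skew4 _ _).
  by apply/rowP=> i; rewrite !mxE; field.
by apply: evalH_ext => k; rewrite /pair2; case: ifP => _; rewrite conjE.
Qed.

(* If the span of [x] and [y] is nondegenerate, then [- 1] acts on it as
   [- refl c], with [c] the cross product. *)
Lemma evalH_oppr f x y b b' : Defs.invariant f ->
  evalH f (pair2 (skew4 (- x) b) (skew4 (- y) b')) =
  evalH f (pair2 (skew4 x b) (skew4 y b')).
Proof.
move=> inv_f; apply/eqP; rewrite -subr_eq0; apply/eqP.
(* The line from the orthonormal pair [(e, e')] at [t = 0] to [(x, y)] at [t = 1] has Gram
   determinant [w] with [w 0 = 1]; the identity, proved where [w] is nonzero, thus extends to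
   [t = 1]. *)
pose e : 'rV[F]_3 := delta_mx 0 0; pose e' : 'rV[F]_3 := delta_mx 0 1.
pose X t := e + t *: (x - e); pose Y t := e' + t *: (y - e').
pose h t := evalH f (pair2 (skew4 (- X t) b) (skew4 (- Y t) b')) -
  evalH f (pair2 (skew4 (X t) b) (skew4 (Y t) b')).
have <- : h 1 = evalH f (pair2 (skew4 (- x) b) (skew4 (- y) b')) -
    evalH f (pair2 (skew4 x b) (skew4 y b')).
  by rewrite /h /X /Y !scale1r ![_ + (_ - _)]addrC !subrK.
pose w t := dot (X t) (X t) * dot (Y t) (Y t) - dot (X t) (Y t) ^+ 2.
apply: (@polyfun_ext _ Finf h w 0 0).
- have [p pE] := evalH_polyfun2 f b b' (-1) e e' (x - e) (y - e').
  have [q qE] := evalH_polyfun2 f b b' 1 e e' (x - e) (y - e').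
  exists (p - q) => t; rewrite hornerD hornerN -pE -qE /h.
  by rewrite !scaleN1r !scale1r.
- pose P (v1 v2 v3 v4 : 'rV[F]_3) : {poly F} :=
    (dot v1 v3)%:P + (dot v1 v4 + dot v2 v3) *: 'X + dot v2 v4 *: 'X^2.
  have PE v1 v2 v3 v4 (t : F) :
      dot (v1 + t *: v2) (v3 + t *: v4) = (P v1 v2 v3 v4).[t].
    rewrite /P !(hornerD, hornerZ, hornerC, hornerX, hornerXn) !dotE.
    by ring.
  exists (P e (x - e) e (x - e) * P e' (y - e') e' (y - e')
    - P e (x - e) e' (y - e') ^+ 2) => t.
  by rewrite hornerD hornerN hornerM horner_exp -!PE.
- rewrite /w /X /Y !scale0r !addr0 !dot3E !mxE /=.
  by rewrite !(mulr0, mulr1, addr0, add0r, expr0n, subr0) oner_eq0.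
move=> t nz; have nz_c : dot (cross (X t) (Y t)) (cross (X t) (Y t)) != 0.
  by rewrite cross_norm.
have := evalH_oppr_refl (X t) (Y t) b b' inv_f nz_c.
rewrite (refl_orth (cross_orthl _ _)) (refl_orth (cross_orthr _ _)) => E.
by rewrite /h E subrr.
Qed.

Lemma evalH_refl_inv f b b' : Defs.invariant f ->
  refl_inv (fun x y => evalH f (pair2 (skew4 x b) (skew4 y b'))).
Proof.
by move=> inv_f u x y nz_u; rewrite -evalH_oppr // evalH_oppr_refl.
Qed.

(** A coordinate reflection of [F^4] reverses the orientation, so it exchanges self-dual and
    anti-self-dual parts, here with a sign. *)
Lemma evalH_swap f a a' b b' : Defs.invariant f ->
  evalH f (pair2 (skew4 (- b) (- a)) (skew4 (- b') (- a'))) =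
  evalH f (pair2 (skew4 a b) (skew4 a' b')).
Proof.
move=> inv_f; pose g : 'M[F]_4 := diag_mx (\row_i if i == 0 then -1 else 1).
have gT : g^T = g by rewrite tr_diag_mx.
have g_orth : Defs.orthogonal g.
  rewrite /Defs.orthogonal gT mulmx_diag -[RHS]diag_const_mx; congr diag_mx.
  by apply/rowP=> i; rewrite !mxE; case: (i == 0); rewrite ?mulrNN mulr1.
rewrite -(inv_f g _ g_orth (pair2_Hminus a a' b b')).
have conjE c e : g *m skew4 c e *m g^T = skew4 (- e) (- c).
  rewrite gT mul_mx_diag mul_diag_mx.
  apply/matrixP=> [[[|[|[|[|//]]]] ?] [[|[|[|[|//]]]] ?]];
    by rewrite !mxE /=; ring.
apply: evalH_ext => k; rewrite act_orthogonal // /pair2.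
by case: ifP => _; rewrite conjE.
Qed.

(** The self-dual parts are replaced first; the swap brings the others into the same position, with
    signs that the Gram entries do not see. *)
Lemma evalH_Gram f a1 a2 b1 b2 a1' a2' b1' b2' : Defs.invariant f ->
    dot a1 a1 = dot a1' a1' -> dot a1 a2 = dot a1' a2' ->
    dot a2 a2 = dot a2' a2' ->
    dot b1 b1 = dot b1' b1' -> dot b1 b2 = dot b1' b2' ->
    dot b2 b2 = dot b2' b2' ->
  evalH f (pair2 (skew4 a1 b1) (skew4 a2 b2)) =
  evalH f (pair2 (skew4 a1' b1') (skew4 a2' b2')).
Proof.
move=> inv_f.
have first_arg c c' x y x' y' : dot x x = dot x' x' -> dot x y = dot x' y' ->
    dot y y = dot y' y' ->
  evalH f (pair2 (skew4 x c) (skew4 y c')) =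
  evalH f (pair2 (skew4 x' c) (skew4 y' c')).
  apply: (@Gram_eq _ _ Finf char2
            (fun x y => evalH f (pair2 (skew4 x c) (skew4 y c')))).
    move=> z t z' t'; have [p pE] := evalH_polyfun2 f c c' 1 z t z' t'.
    by exists p => s; rewrite -pE !scale1r.
  exact: evalH_refl_inv.
move=> a11 a12 a22 b11 b12 b22.
rewrite (first_arg _ _ _ _ _ _ a11 a12 a22) -evalH_swap //.
by rewrite (first_arg _ _ _ _ (- b1') (- b2')) ?evalH_swap // !dotE ?b11 ?b12 ?b22.
Qed.

End O4Orbits.

(** * Values of the generators *)

Section EvaluationMorphism.
Variables (F : fieldType) (n d : nat).
Hypothesis char2 : 2%:R != 0 :> F.
Implicit Types (v : tuples F n d).

Definition evalmx v m p (M : 'M[Rminus F n d]_(m, p)) : 'M[F]_(m, p) :=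
  map_mx (fun f => evalH f v) M.

Lemma evalH_det v m (M : 'M_m) : evalH (\det M) v = \det (evalmx v M).
Proof. exact/esym/det_map_mx. Qed.

Lemma evalH_tr v m (M : 'M_m) : evalH (\tr M) v = \tr (evalmx v M).
Proof. exact/esym/trace_map_mx. Qed.

Lemma evalmxM v m p q (A : 'M_(m, p)) (B : 'M_(p, q)) :
  evalmx v (A *m B) = evalmx v A *m evalmx v B.
Proof. exact: map_mxM. Qed.

Lemma evalmxX v m (A : 'M_m.+1) k : evalmx v (A ^+ k) = evalmx v A ^+ k.
Proof.
elim: k => [|k IHk]; first by rewrite !expr0; exact: map_mx1.
by rewrite !exprS -!mulmxE evalmxM IHk.
Qed.

Lemma evalH_sigma v m t (M : 'M_m) : evalH (sigma t M) v = sigma t (evalmx v M).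
Proof.
rewrite /sigma /evalmx /evalH mevalM rmorph_sign; congr (_ * _).
by rewrite -map_char_poly coef_map.
Qed.

(** Only entries below the diagonal are variables; skew-symmetry of [v k] supplies the others, the
    zero diagonal through [char2]. *)
Lemma evalmx_Z v (k : 'I_d) : Hminus v -> evalmx v (Z F n k) = v k.
Proof.
move=> skew_v; have vE i j : v k i j = - v k j i.
  by have /matrixP/(_ j i) := skew_v k; rewrite !mxE.
apply/matrixP=> i j; rewrite !mxE.
case: insubP => [s _ sE|]; first by rewrite /evalH mevalXU enum_rankK sE.
rewrite /= -leqNgt => le_ij.
case: insubP => [s _ sE|]; first by rewrite /evalH mevalN mevalXU enum_rankK sE /= -vE.
rewrite /= -leqNgt => le_ji; rewrite /evalH meval0.
have -> : i = j by apply/val_inj/anti_leq; rewrite le_ij.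
apply/esym/eqP; have /eqP := vE j j; rewrite -subr_eq0 opprK -mulr2n -mulr_natl.
by rewrite mulf_eq0 (negPf char2).
Qed.

End EvaluationMorphism.

(** * Conjugation invariance of traces and characteristic coefficients *)

Section Conjugation.
Variables (F : fieldType) (n : nat).
Implicit Types (g A B : 'M[F]_n).

Lemma mulmx_conj g A B : g \in unitmx ->
  (g *m A *m invmx g) *m (g *m B *m invmx g) = g *m (A *m B) *m invmx g.
Proof. by move=> ug; rewrite !mulmxA mulmxKV. Qed.

Lemma tr_conj g A : g \in unitmx -> \tr (g *m A *m invmx g) = \tr A.
Proof. by move=> ug; rewrite mxtrace_mulC mulKmx. Qed.

Lemma sigma_conj g A t : g \in unitmx -> sigma t (g *m A *m invmx g) = sigma t A.
Proof.
move=> ug; rewrite /sigma.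
suff -> : char_poly (g *m A *m invmx g) = char_poly A by [].
rewrite /char_poly.
pose G := map_mx polyC g; pose G' := map_mx polyC (invmx g).
have GG' : G *m G' = 1%:M by rewrite -map_mxM mulmxV // map_mx1.
have -> : char_poly_mx (g *m A *m invmx g) = G *m char_poly_mx A *m G'.
  rewrite /char_poly_mx mulmxBr mulmxBl !map_mxM mul_mx_scalar -scalemxAl GG'.
  by rewrite scalemx1.
by rewrite !det_mulmx mulrAC -det_mulmx GG' det1 mul1r.
Qed.

Lemma det_conj g A : g \in unitmx -> \det (g *m A *m invmx g) = \det A.
Proof.
by move=> ug; rewrite !det_mulmx mulrAC -det_mulmx mulmxV // det1 mul1r.
Qed.

End Conjugation.

Section DeterminantExpansion.
Variable R : comNzRingType.

(** Laplace expansion along the first row; natural-number indices let it unfold by computation. *)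
Fixpoint det_nat n (a : nat -> nat -> R) : R :=
  if n is n'.+1 then \sum_(j < n'.+1)
    a 0%N j * ((-1) ^+ j * det_nat n' (fun i k => a i.+1 (bump j k)))
  else 1.

Lemma det_matrix_nat n (a : nat -> nat -> R) :
  \det (\matrix_(i < n, j < n) a i j) = det_nat n a.
Proof.
elim: n a => [|n IHn] a; first exact: det_mx00.
rewrite (expand_det_row _ ord0); apply: eq_bigr => j _; rewrite mxE /cofactor.
congr (_ * (_ * _)); apply: etrans (IHn _); congr (\det _).
by apply/matrixP=> i k; rewrite !mxE.
Qed.

End DeterminantExpansion.

Lemma sigma2_mx4 (R : comNzRingType) (A : 'M[R]_4) : sigma 2 A =
    A 0 0 * A 1 1 - A 0 1 * A 1 0
  + (A 0 0 * A 2%:R 2%:R - A 0 2%:R * A 2%:R 0)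
  + (A 0 0 * A 3%:R 3%:R - A 0 3%:R * A 3%:R 0)
  + (A 1 1 * A 2%:R 2%:R - A 1 2%:R * A 2%:R 1)
  + (A 1 1 * A 3%:R 3%:R - A 1 3%:R * A 3%:R 1)
  + (A 2%:R 2%:R * A 3%:R 3%:R - A 2%:R 3%:R * A 3%:R 2%:R).
Proof.
rewrite /sigma sqrrN expr1n mul1r.
pose a k l := A (inord k) (inord l).
have aE (i j : 'I_4) : A i j = a i j by rewrite /a !inord_val.
rewrite !aE /=.
have -> : char_poly A = det_nat 4 (fun k l => 'X *+ (k == l) - (a k l)%:P).
  rewrite -det_matrix_nat; congr (\det _).
  by apply/matrixP=> i j; rewrite !mxE aE.
clearbody a; clear aE A.
rewrite /det_nat !big_ord_recl !big_ord0 /= /bump /=.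
rewrite !(addn0, add0n, add1n).
(* [m] gives the principal minors of order 3, and [M] those of the last three rows, so [c0] is the
   determinant expanded along the first row. *)
pose m i j k := a i i * (a j j * a k k - a j k * a k j)
  - a i j * (a j i * a k k - a j k * a k i)
  + a i k * (a j i * a k j - a j j * a k i).
pose M j k l := a 1%N j * (a 2%N k * a 3%N l - a 2%N l * a 3%N k)
  - a 1%N k * (a 2%N j * a 3%N l - a 2%N l * a 3%N j)
  + a 1%N l * (a 2%N j * a 3%N k - a 2%N k * a 3%N j).
pose c0 := a 0%N 0%N * M 1%N 2%N 3%N - a 0%N 1%N * M 0%N 2%N 3%N
  + a 0%N 2%N * M 0%N 1%N 3%N - a 0%N 3%N * M 0%N 1%N 2%N.
pose c1 := m 0%N 1%N 2%N + m 0%N 1%N 3%N + m 0%N 2%N 3%N + m 1%N 2%N 3%N.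
pose c3 := a 0%N 0%N + a 1%N 1%N + a 2%N 2%N + a 3%N 3%N.
set c2 := RHS.
(* One [ring] call identifies the whole polynomial; its coefficient is then read off with the [c]'s
   kept opaque. *)
suff E : forall p : {poly R},
    p = 'X ^+ 4 - c3%:P * 'X ^+ 3 + c2%:P * 'X ^+ 2 - c1%:P * 'X + c0%:P ->
    p`_2 = c2.
  by apply: E; rewrite /c0 /c1 /c2 /c3 /m /M; ring.
by move=> p ->; rewrite !(coefD, coefN, coefCM, coefXn, coefX, coefC) /=; ring.
Qed.

Section Skew4Values.
Variable F : fieldType.
Implicit Types (a b : 'rV[F]_3).

Lemma det_skew4 a b : \det (skew4 a b) = (dot a a - dot b b) ^+ 2.
Proof.
rewrite /skew4 (det_matrix_nat 4 (fun i j => nth 0 (nth [::] _ i) j)).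
rewrite /det_nat !big_ord_recl !big_ord0 /= !dot3E; ring.
Qed.

Lemma sigma2_skew4 a b : sigma 2 (skew4 a b) = 2%:R * (dot a a + dot b b).
Proof. by rewrite sigma2_mx4 !dot3E !mxE /=; ring. Qed.

Lemma tr_skew4M a b a' b' :
  \tr (skew4 a b *m skew4 a' b') = - (4%:R * (dot a a' + dot b b')).
Proof.
rewrite /mxtrace !big_ord_recl big_ord0 !mxE !big_ord_recl !big_ord0 !mxE /=.
by rewrite !dot3E; ring.
Qed.

(* With Z = skew4 a b and W = skew4 a (- b), both Z W and Z^2 + W^2 are
   scalar, so Z^3 = Z (Z^2 + W^2) - (Z W) W is a combination of Z and W. *)
Lemma skew4_cube a b : skew4 a b *m (skew4 a b *m skew4 a b) =
  skew4 (- (dot a a + 3%:R * dot b b) *: a) (- (3%:R * dot a a + dot b b) *: b).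
Proof.
have /eqP := skew4_sqrD a b; rewrite -subr_eq0 -addrA addr_eq0 => /eqP ->.
rewrite opprB mulmxBr mulmxA skew4_mul_dual mul_mx_scalar mul_scalar_mx.
rewrite -scaleN1r -!skew4Z -skew4D.
by congr skew4; apply/rowP=> i; rewrite !mxE; ring.
Qed.

Lemma tr_skew4_cubeM a b a' b' :
  \tr (skew4 a b *m (skew4 a b *m skew4 a b) *m skew4 a' b') =
  4%:R * ((dot a a + 3%:R * dot b b) * dot a a'
          + (3%:R * dot a a + dot b b) * dot b b').
Proof. by rewrite skew4_cube tr_skew4M !dotE; ring. Qed.

Lemma tr_skew4_sqrM a b a' b' :
  \tr (skew4 a b *m skew4 a b *m (skew4 a' b' *m skew4 a' b')) =
  4%:R * (dot a a + dot b b) * (dot a' a' + dot b' b')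
  + 16%:R * dot a a' * dot b b'.
Proof.
rewrite /mxtrace !big_ord_recl big_ord0 ![(_ *m _ *m (_ *m _)) _ _]mxE.
rewrite !big_ord_recl !big_ord0.
rewrite ![(skew4 _ _ *m _) _ _]mxE !big_ord_recl !big_ord0 !mxE /= !dot3E.
by ring.
Qed.

Lemma sigma2_skew4M a b a' b' : sigma 2 (skew4 a b *m skew4 a' b') =
  4%:R * (dot a a' + dot b b') ^+ 2
  + 2%:R * (dot a a - dot b b) * (dot a' a' - dot b' b').
Proof.
rewrite sigma2_mx4 !mxE !big_ord_recl !big_ord0 !mxE /= !dot3E.
by ring.
Qed.

End Skew4Values.

(** * Recovering the unordered pair of Gram matrices *)

Section GramValues.
Variable F : fieldType.

(* Here [p] and [q] are the Gram entries of the self-dual and anti-self-dual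
   parts. *)
Definition gram_values (p11 p12 p22 q11 q12 q22 : F) : seq F := [::
  2%:R * (p11 + q11); 2%:R * (p22 + q22); (p11 - q11) ^+ 2; (p22 - q22) ^+ 2;
  - (4%:R * (p12 + q12));
  4%:R * (p12 + q12) ^+ 2 + 2%:R * (p11 - q11) * (p22 - q22);
  4%:R * (p11 + q11) * (p22 + q22) + 16%:R * p12 * q12;
  4%:R * ((p11 + 3%:R * q11) * p12 + (3%:R * p11 + q11) * q12);
  4%:R * ((p22 + 3%:R * q22) * p12 + (3%:R * p22 + q22) * q12)].

(** The sign is read off at the first nonzero coordinate and carried to the others by the mixed
    products. *)
Lemma eq_up_to_sign (x y z x' y' z' : F) :
    x ^+ 2 = x' ^+ 2 -> y ^+ 2 = y' ^+ 2 -> z ^+ 2 = z' ^+ 2 ->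
    x * y = x' * y' -> x * z = x' * z' -> y * z = y' * z' ->
  [/\ x = x', y = y' & z = z'] \/ [/\ x = - x', y = - y' & z = - z'].
Proof.
have cancel (e s t s' t' : F) :
    s != 0 -> s = e * s' -> e * e = 1 -> s * t = s' * t' -> t = e * t'.
  by move=> nz_s sE ee st; apply: (mulfI nz_s); rewrite st sE mulrACA ee mul1r.
move=> xx yy zz xy xz yz.
have signs (s s' : F) : s ^+ 2 = s' ^+ 2 ->
    exists2 e : F, (e == 1) || (e == -1) & s = e * s'.
  move/eqP; rewrite eqf_sqr => /orP[/eqP->|/eqP->].
    by exists 1; rewrite ?eqxx ?mul1r.
  by exists (-1); rewrite ?eqxx ?orbT ?mulN1r.
suff [e /orP[]/eqP-> [-> -> ->]] : exists2 e : F, (e == 1) || (e == -1) &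
    [/\ x = e * x', y = e * y' & z = e * z'].
- by left; rewrite !mul1r.
- by right; rewrite !mulN1r.
have ee (e : F) : (e == 1) || (e == -1) -> e * e = 1.
  by case/orP=> /eqP->; rewrite ?mulrNN mulr1.
have z0 (s s' : F) : s ^+ 2 = s' ^+ 2 -> s = 0 -> s' = 0.
  by move=> ss s0; apply/eqP; rewrite -sqrf_eq0 -ss s0 expr0n.
have [x0|nz_x] := eqVneq x 0; last first.
  have [e eP xE] := signs _ _ xx; exists e => //.
  have cancel_x := cancel e _ _ _ _ nz_x xE (ee _ eP).
  by rewrite (cancel_x _ _ xy) (cancel_x _ _ xz).
have [y0|nz_y] := eqVneq y 0; last first.
  have [e eP yE] := signs _ _ yy; exists e => //.
  by rewrite (cancel e _ _ _ _ nz_y yE (ee _ eP) yz) x0 (z0 _ _ xx x0) mulr0.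
have [e eP zE] := signs _ _ zz; exists e => //.
by rewrite x0 y0 (z0 _ _ xx x0) (z0 _ _ yy y0) mulr0.
Qed.

Hypothesis char2 : 2%:R != 0 :> F.

(** The values determine [s = p + q], and [d = p - q] up to a common sign; changing that sign
    exchanges [p] and [q]. *)
Lemma gram_values_inj (p11 p12 p22 q11 q12 q22 p11' p12' p22' q11' q12' q22' : F) :
    gram_values p11 p12 p22 q11 q12 q22 =
    gram_values p11' p12' p22' q11' q12' q22' ->
  (p11, p12, p22, (q11, q12, q22)) = (p11', p12', p22', (q11', q12', q22')) \/
  (p11, p12, p22, (q11, q12, q22)) = (q11', q12', q22', (p11', p12', p22')).
Proof.
case=> s11 s22 d11 d22 s12 dd t22 t31 t13.
have mul2I (s t : F) : 2%:R * s = 2%:R * t -> s = t by apply: mulfI.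
have mul4I (s t : F) : 4%:R * s = 4%:R * t -> s = t.
  by move=> st; apply: (mul2I); apply: (mul2I); rewrite !mulrA -natrM.
move/mul2I: s11 => s11; move/mul2I: s22 => s22; move/oppr_inj/mul4I: s12 => s12.
(* The determinants give [d11^2] and [d22^2]. The other products come from [sigma_2(Z1 Z2)] for
   [d11 d22], from [tr(Z1^2 Z2^2)] for [d12^2 = s12^2 - 4 p12 q12], and from the two remaining
   traces for [d11 d12] and [d22 d12]. *)
have dd1122 : (p11 - q11) * (p22 - q22) = (p11' - q11') * (p22' - q22').
  by apply: (mul2I); move: dd; rewrite s12 !mulrA => /addrI.
have pq12 : p12 * q12 = p12' * q12'.
  apply: (mul4I); apply: (mul4I); move: t22; rewrite -(mulrA 4%:R) s11 s22 mulrA => /addrI.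
  by rewrite !mulrA -!natrM.
have dd1212 : (p12 - q12) ^+ 2 = (p12' - q12') ^+ 2.
  have sqE (p q : F) : (p - q) ^+ 2 = (p + q) ^+ 2 - 4%:R * (p * q) by ring.
  by rewrite !sqE s12 pq12.
have mixed (p q p' q' s t s' t' : F) : p + q = p' + q' -> s + t = s' + t' ->
    4%:R * ((p + 3%:R * q) * s + (3%:R * p + q) * t) =
    4%:R * ((p' + 3%:R * q') * s' + (3%:R * p' + q') * t') ->
    (p - q) * (s - t) = (p' - q') * (s' - t').
  move=> pq st /mul4I E.
  have dE (a b c e : F) : (a - b) * (c - e) = 2%:R * ((a + b) * (c + e))
      - ((a + 3%:R * b) * c + (3%:R * a + b) * e) by ring.
  by rewrite !dE pq st E.
have dd1112 := mixed _ _ _ _ _ _ _ _ s11 s12 t31.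
have dd2212 := mixed _ _ _ _ _ _ _ _ s22 s12 t13.
have same (p q p' q' : F) :
    p + q = p' + q' -> p - q = p' - q' -> p = p' /\ q = q'.
  move=> sE dE; split; apply: (mul2I).
    have -> : 2%:R * p = (p + q) + (p - q) by ring.
    by rewrite sE dE; ring.
  have -> : 2%:R * q = (p + q) - (p - q) by ring.
  by rewrite sE dE; ring.
have swap (p q p' q' : F) :
    p + q = p' + q' -> p - q = - (p' - q') -> p = q' /\ q = p'.
  by rewrite (addrC p') opprB; apply: same.
have [] := eq_up_to_sign d11 d22 dd1212 dd1122 dd1112 dd2212.
  case=> e11 e22 e12; left.
  by have [-> ->] := same _ _ _ _ s11 e11; have [-> ->] := same _ _ _ _ s22 e22;
     have [-> ->] := same _ _ _ _ s12 e12.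
case=> e11 e22 e12; right.
by have [-> ->] := swap _ _ _ _ s11 e11; have [-> ->] := swap _ _ _ _ s22 e22;
   have [-> ->] := swap _ _ _ _ s12 e12.
Qed.

End GramValues.

(** * Separation and irredundancy of the nine invariants *)

Section Generators.
Variable F : fieldType.
Hypothesis char2 : 2%:R != 0 :> F.

Let Z1 := Z F 4 (ord0 : 'I_2).
Let Z2 := Z F 4 (ord_max : 'I_2).

Definition generators : seq (Rminus F 4 2) :=
  [:: sigma 2 Z1; sigma 2 Z2; \det Z1; \det Z2;
      \tr (Z1 *m Z2); sigma 2 (Z1 *m Z2); \tr (Z1 ^+ 2 *m Z2 ^+ 2);
      \tr (Z1 ^+ 3 *m Z2); \tr (Z1 *m Z2 ^+ 3)].

(** The last trace is permuted cyclically so that [tr_skew4_cubeM] applies to it as well. *)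
Lemma generators_eval (v : tuples F 4 2) : Hminus v ->
  let A := v ord0 in let B := v ord_max in
  [seq evalH f v | f <- generators] =
  [:: sigma 2 A; sigma 2 B; \det A; \det B; \tr (A *m B); sigma 2 (A *m B);
      \tr (A *m A *m (B *m B)); \tr (A *m (A *m A) *m B);
      \tr (B *m (B *m B) *m A)].
Proof.
move=> skew_v A B.
have Z1E : evalmx v Z1 = A by exact: evalmx_Z.
have Z2E : evalmx v Z2 = B by exact: evalmx_Z.
rewrite /generators /=; congr [:: _; _; _; _; _; _; _; _; _].
- by rewrite evalH_sigma Z1E.
- by rewrite evalH_sigma Z2E.
- by rewrite evalH_det Z1E.
- by rewrite evalH_det Z2E.
- by rewrite evalH_tr evalmxM Z1E Z2E.
- by rewrite evalH_sigma evalmxM Z1E Z2E.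
- by rewrite evalH_tr evalmxM !evalmxX Z1E Z2E.
- by rewrite evalH_tr evalmxM evalmxX Z1E Z2E.
- by rewrite evalH_tr evalmxM evalmxX Z1E Z2E mxtrace_mulC.
Qed.

Lemma generators_invariant f : f \in generators -> Defs.invariant f.
Proof.
move=> fS g v g_orth skew_v.
suff /eq_in_map-> : [seq evalH f (act g v) | f <- generators] =
  [seq evalH f v | f <- generators] by [].
rewrite !generators_eval //; last exact: act_Hminus.
have [_ ug] := mulmx1_unit g_orth; rewrite unitmx_tr in ug.
by rewrite /act !mulmx_conj // !sigma_conj // !det_conj // !tr_conj.
Qed.

Lemma generators_skew4 (a a' b b' : 'rV[F]_3) :
  [seq evalH f (pair2 (skew4 a b) (skew4 a' b')) | f <- generators] =
  gram_values (dot a a) (dot a a') (dot a' a') (dot b b) (dot b b') (dot b' b').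
Proof.
rewrite generators_eval; last exact: pair2_Hminus.
rewrite /pair2 eqxx /= !sigma2_skew4 !det_skew4 tr_skew4M sigma2_skew4M.
by rewrite tr_skew4_sqrM !tr_skew4_cubeM (dotC a' a) (dotC b' b).
Qed.

(** If all nine values agree, the Gram matrices agree up to exchange, and [evalH_Gram], combined
    with [evalH_swap] in the exchanged case, equates every invariant. *)
Lemma generators_separating (Finf : infinite_type F) :
  separating (fun f => f \in generators).
Proof.
split=> [f|u v skew_u skew_v [f inv_f fuv]]; first exact: generators_invariant.
have [/allP eq_all|/allPn[h hS /eqP huv]] :=
  boolP (all (fun f => evalH f u == evalH f v) generators); last by exists h.
case: fuv.
have [a [a' [b [b' uE]]]] := pair2_skew4_surj char2 skew_u.
have [c [c' [e [e' vE]]]] := pair2_skew4_surj char2 skew_v.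
have : [seq evalH f u | f <- generators] = [seq evalH f v | f <- generators].
  by apply/eq_in_map=> h /eq_all/eqP.
rewrite (eq_map (fun f => evalH_ext f uE)) (eq_map (fun f => evalH_ext f vE)).
rewrite !generators_skew4 => /(gram_values_inj char2).
rewrite (evalH_ext f uE) (evalH_ext f vE).
case=> [[p11 p12 p22 q11 q12 q22]|[p11 p12 p22 q11 q12 q22]].
  exact: evalH_Gram.
rewrite -(evalH_swap c c' e e') //.
by apply: evalH_Gram; rewrite ?dotNl ?dotNr ?opprK.
Qed.

Definition vec3 (x y z : F) : 'rV[F]_3 := \row_i nth 0 [:: x; y; z] i.

Lemma dot_vec3 x y z x' y' z' :
  dot (vec3 x y z) (vec3 x' y' z') = x * x' + y * y' + z * z'.
Proof. by rewrite dot3E !mxE. Qed.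

Definition differ_only_at i (u v : tuples F 4 2) :=
  [/\ Hminus u, Hminus v,
      nth 0 [seq evalH f u | f <- generators] i !=
      nth 0 [seq evalH f v | f <- generators] i &
      forall j, (j < 9)%N -> j != i ->
        nth 0 [seq evalH f u | f <- generators] j =
        nth 0 [seq evalH f v | f <- generators] j].

(** Requiring the difference to be a power of 2 makes it nonzero under [char2] alone and leaves only
    ring identities to check. *)
Lemma differ_only_at_skew4 i k (a a' b b' c c' d d' : 'rV[F]_3) :
    let U := gram_values (dot a a) (dot a a') (dot a' a')
                         (dot b b) (dot b b') (dot b' b') in
    let V := gram_values (dot c c) (dot c c') (dot c' c')
                         (dot d d) (dot d d') (dot d' d') in
    nth 0 U i - nth 0 V i = 2%:R ^+ k ->
    (forall j, (j < 9)%N -> j != i -> nth 0 U j = nth 0 V j) ->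
  exists u v, differ_only_at i u v.
Proof.
move=> U V UV eqUV; exists (pair2 (skew4 a b) (skew4 a' b')).
exists (pair2 (skew4 c d) (skew4 c' d')); rewrite /differ_only_at.
rewrite !generators_skew4; split; [exact: pair2_Hminus..| |done].
by rewrite -subr_eq0 UV expf_neq0.
Qed.

Ltac compare_values :=
  try case=> [|[|[|[|[|[|[|[|[|//]]]]]]]]];
  rewrite /= ?dot_vec3 //; try (move=> _ _); ring.

(** In terms of [s] and [d]: for [sigma_2(Z_i)], [s_ii] varies with [d = 0]; for [det(Z_i)], only
    [d_ii] varies; for [sigma_2(Z1 Z2)], [d22] changes sign with [d12 = 0]; for [tr(Z1^2 Z2^2)],
    [d12] varies with [d11 = d22 = 0]; for the last two, [d12] changes sign with [d22 = 0],
    respectively [d11 = 0]. *)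
Lemma generators_irredundant i : (i < 9)%N -> exists u v, differ_only_at i u v.
Proof.
pose o := vec3 0 0 0; pose e1 := vec3 1 0 0.
pose e2 := vec3 0 1 0; pose e3 := vec3 0 0 1.
pose e12 := vec3 1 1 0; pose e13 := vec3 1 0 1; pose e12' := vec3 1 (-1) 0.
case: i => [|[|[|[|[|[|[|[|[|//]]]]]]]]] _.
- by apply: (@differ_only_at_skew4 _ 2 e1 o e1 o o o o o); compare_values.
- by apply: (@differ_only_at_skew4 _ 2 o e1 o e1 o o o o); compare_values.
- by apply: (@differ_only_at_skew4 _ 2 e12 o o o e1 o e1 o); compare_values.
- by apply: (@differ_only_at_skew4 _ 2 o e12 o o o e1 o e1); compare_values.
- (* Negating Z2 changes tr (Z1 Z2); the vectors are chosen so that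
     tr (Z1^3 Z2) = tr (Z1 Z2^3) = 0, i.e. 2 s_ii s_12 = d_ii d_12. *)
  by apply: (@differ_only_at_skew4 _ 3 (vec3 2%:R 0 1) (vec3 0 1 (- 2%:R)) e1 e1
    (vec3 2%:R 0 1) (vec3 0 (-1) 2%:R) e1 (vec3 (-1) 0 0)); compare_values.
- by apply: (@differ_only_at_skew4 _ 2 e1 e2 o o e1 o o e2); compare_values.
- by apply: (@differ_only_at_skew4 _ 4 e12 e13 e12 e13 e12 e12 e12 e12'); compare_values.
- by apply: (@differ_only_at_skew4 _ 3 e12 e3 e1 e1 e12 e1 e1 e2); compare_values.
- by apply: (@differ_only_at_skew4 _ 3 e3 e12 e1 e1 e1 e12 e2 e1); compare_values.
Qed.

End Generators.

Theorem theorem5p1 (F : fieldType) (Finf : infinite_type F)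
    (charF : 2%N \notin [pchar F]) :
  let Z1 := Z F 4 (ord0 : 'I_2) in
  let Z2 := Z F 4 (ord_max : 'I_2) in
  minimal_separating (fun f : Rminus F 4 2 => f \in
    [:: sigma 2 Z1; sigma 2 Z2; \det Z1; \det Z2;
        \tr (Z1 *m Z2); sigma 2 (Z1 *m Z2); \tr (Z1 ^+ 2 *m Z2 ^+ 2);
        \tr (Z1 ^+ 3 *m Z2); \tr (Z1 *m Z2 ^+ 3)]).
Proof.
have char2 : 2%:R != 0 :> F by apply: contra charF => two0; rewrite inE.
move=> Z1 Z2; rewrite -/(generators F).
split=> [|S' sub_S' nsub [_ sepS']]; first exact: generators_separating.
(* Each generator [f] is shown to lie in [S']: the pair differing only at [f] is separated by some
   [h] in [S'], which must then be [f]. *)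
case: nsub => f fS; have iS := fS; rewrite -index_mem in iS.
have [u [v [skew_u skew_v fuv eq_uv]]] := generators_irredundant char2 iS.
have [|h S'h huv] := sepS' u v skew_u skew_v.
  exists f; first exact: generators_invariant.
  by move: fuv; rewrite !(nth_map 0) // nth_index // => /eqP.
have hS := sub_S' h S'h.
have [<-//|neq_fh] := eqVneq h f; case: huv.
have := eq_uv (index h (generators F)).
rewrite -[X in (_ < X)%N]/(size (generators F)) index_mem hS.
rewrite !(nth_map 0) ?index_mem // nth_index //.
apply=> //; apply: contra neq_fh => /eqP eq_index.
by rewrite -(nth_index 0 hS) eq_index nth_index.
Qed.
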